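(* Let $(A,\diamond,*,[\,,\,,\,],[\![\,,\,,\,]\!])$ be an NS-Nambu-Poisson algebra. Set $$a\odot b=a\diamond b+b\diamond a+a*b,\qquad \{\!\!\{a,b,c\}\!\!\}=[a,b,c]+[b,c,a]+[c,a,b]+[\![a,b,c]\!].$$ (i) Then $(A,\odot,\{\!\!\{\,,\,,\,\}\!\!\})$ is a Nambu-Poisson algebra (called the subadjacent Nambu-Poisson algebra). (ii) Define $\mu_\diamond:A\to\mathrm{End}(A)$ by $\mu_\diamond(a)b=a\diamond b$ and $\rho_{[\,,\,,\,]}:A\times A\to\mathrm{End}(A)$ by $\rho_{[\,,\,,\,]}(a,b)c=[a,b,c]$. Then the triple $(A;\mu_\diamond,\rho_{[\,,\,,\,]})$ is a representation of the subadjacent Nambu-Poisson algebra $(A,\odot,\{\!\!\{\,,\,,\,\}\!\!\})$. Moreover, with $\varphi_*(a,b)=a*b$ and $\psi_{[\![\,,\,,\,]\!]}(a,b,c)=[\![a,b,c]\!]$, the pair $(\varphi_*,\psi_{[\![\,,\,,\,]\!]})$ is a Nambu-Poisson $2$-cocycle of the subadjacent Nambu-Poisson algebra with coefficients in the representation $(A;\mu_\diamond,\rho_{[\,,\,,\,]})$.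
   Context: All vector spaces and (multi)linear maps are over a field $k$ of characteristic $0$. A 3-Lie algebra is a vector space $\mathcal L$ with a skew-symmetric trilinear operation $\{\,,\,,\,\}$ satisfying $\{a,b,\{c,d,e\}\}=\{\{a,b,c\},d,e\}+\{c,\{a,b,d\},e\}+\{c,d,\{a,b,e\}\}$. A Nambu-Poisson algebra $(A,\cdot,\{\,,\,,\,\})$ is a commutative associative algebra $(A,\cdot)$ (not assumed unital) together with a 3-Lie algebra structure $\{\,,\,,\,\}$ on $A$ such that $\{a,b,c\cdot d\}=\{a,b,c\}\cdot d+c\cdot\{a,b,d\}$ for all $a,b,c,d\in A$. A representation of a Nambu-Poisson algebra $(A,\cdot,\{\,,\,,\,\})$ is a triple $(V;\mu,\rho)$ of a vector space $V$, a linear map $\mu:A\to\mathrm{End}(V)$ and a skew-symmetric bilinear map $\rho:A\times A\to\mathrm{End}(V)$ such that for all $a,b,c,d\in A$: $\mu(a\cdot b)=\mu(a)\mu(b)$; $\rho(a,b)\rho(c,d)-\rho(c,d)\rho(a,b)=\rho(\{a,b,c\},d)+\rho(c,\{a,b,d\})$; $\rho(\{a,b,c\},d)=\rho(a,b)\rho(c,d)+\rho(b,c)\rho(a,d)+\rho(c,a)\rho(b,d)$; $\mu(\{a,b,c\})=\rho(a,b)\mu(c)-\mu(c)\rho(a,b)$; $\rho(a,b\cdot c)=\mu(b)\rho(a,c)+\mu(c)\rho(a,b)$. A Nambu-Poisson 2-cocycle of $A$ with coefficients in $(V;\mu,\rho)$ is a pair $(\varphi,\psi)$ where: (1) $\varphi:A\times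 A\to V$ is a Harrison 2-cocycle, i.e. bilinear, symmetric, with $\mu(a)\varphi(b,c)-\varphi(a\cdot b,c)+\varphi(a,b\cdot c)-\mu(c)\varphi(a,b)=0$; (2) $\psi:A\times A\times A\to V$ is a 3-Lie 2-cocycle, i.e. trilinear, skew-symmetric, with $\psi(a,b,\{c,d,e\})+\rho(a,b)\psi(c,d,e)=\psi(\{a,b,c\},d,e)+\psi(c,\{a,b,d\},e)+\psi(c,d,\{a,b,e\})+\rho(d,e)\psi(a,b,c)+\rho(e,c)\psi(a,b,d)+\rho(c,d)\psi(a,b,e)$; (3) $\psi(a,b,c\cdot d)+\rho(a,b)\varphi(c,d)=\varphi(c,\{a,b,d\})+\mu(c)\psi(a,b,d)+\varphi(\{a,b,c\},d)+\mu(d)\psi(a,b,c)$, for all $a,b,c,d,e\in A$. An NS-commutative algebra is $(A,\diamond,* )$ with bilinear operations $\diamond,*$ on $A$, $*$ commutative, such that, with $a\odot b=a\diamond b+b\diamond a+a*b$: $a\diamond(b\diamond c)=(a\odot b)\diamond c$ and $a\diamond(b*c)+a*(b\odot c)=b\diamond(a*c)+b*(a\odot c)$. An NS-3-Lie algebra is $(A,[\,,\,,\,],[\![\,,\,,\,]\!])$ with trilinear operations on $A$, $[\,,\,,\,]$ skew-symmetric in the first two arguments and $[\![\,,\,,\,]\!]$ completely skew-symmetric, such that, with $\{\!\!\{a,b,c\}\!\!\}=[a,b,c]+[b,c,a]+[c,a,b]+[\![a,b,c]\!]$: $[a,b,[c,d,e]]=[\{\!\!\{a,b,c\}\!\!\},d,e]+[c,\{\!\!\{a,b,d\}\!\!\},e]+[c,d,[a,b,e]]$;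 $[\{\!\!\{a,b,c\}\!\!\},d,e]=[a,b,[c,d,e]]+[b,c,[a,d,e]]+[c,a,[b,d,e]]$; $[\![a,b,\{\!\!\{c,d,e\}\!\!\}]\!]+[a,b,[\![c,d,e]\!]]=[\![\{\!\!\{a,b,c\}\!\!\},d,e]\!]+[\![c,\{\!\!\{a,b,d\}\!\!\},e]\!]+[\![c,d,\{\!\!\{a,b,e\}\!\!\}]\!]+[d,e,[\![a,b,c]\!]]+[e,c,[\![a,b,d]\!]]+[c,d,[\![a,b,e]\!]]$. An NS-Nambu-Poisson algebra is $(A,\diamond,*,[\,,\,,\,],[\![\,,\,,\,]\!])$ such that $(A,\diamond,* )$ is an NS-commutative algebra, $(A,[\,,\,,\,],[\![\,,\,,\,]\!])$ is an NS-3-Lie algebra, and for all $a,b,c,d\in A$: $\{\!\!\{a,b,c\}\!\!\}\diamond d=[a,b,c\diamond d]-c\diamond[a,b,d]$; $[a\odot b,c,d]=a\diamond[b,c,d]+b\diamond[a,c,d]$; $[\![a,b,c\odot d]\!]+[a,b,c*d]=c*\{\!\!\{a,b,d\}\!\!\}+c\diamond[\![a,b,d]\!]+\{\!\!\{a,b,c\}\!\!\}*d+d\diamond[\![a,b,c]\!]$. *)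

(* Defs.v *)
From mathcomp Require Import all_boot all_algebra.

Set Implicit Arguments.
Unset Strict Implicit.
Unset Printing Implicit Defensive.

Import GRing.Theory.
Local Open Scope ring_scope.

(* Vector spaces are [lmodType k], of arbitrary dimension.  All structures are
   predicates on raw operations, so that they apply to derived operations.   *)

Section Multilinear.
Variables (k : fieldType) (U1 U2 U3 W : lmodType k).

Definition bilinear_map (f : U1 -> U2 -> W) : Prop :=
  (forall y, linear (f^~ y)) /\ (forall x, linear (f x)).

Definition trilinear_map (f : U1 -> U2 -> U3 -> W) : Prop :=
  [/\ forall y z, linear (fun x => f x y z),
      forall x z, linear (fun y => f x y z)
    & forall x y, linear (f x y)].

End Multilinear.

Definition skew_in_first_two (k : fieldType) (U V W : lmodType k)
    (f : U -> U -> V -> W) : Prop :=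
  forall a b v, f b a v = - f a b v.

Definition skew_symmetric3 (k : fieldType) (U W : lmodType k)
    (f : U -> U -> U -> W) : Prop :=
  forall a b c,
    [/\ f b a c = - f a b c, f a c b = - f a b c & f c b a = - f a b c].

Section NambuPoisson.
Variables (k : fieldType) (A : lmodType k).
Implicit Types (mul : A -> A -> A) (br : A -> A -> A -> A).

Record is_3Lie br : Prop := {
  lie3_trilinear : trilinear_map br;
  lie3_skew : skew_symmetric3 br;
  lie3_fundamental : forall a b c d e,
    br a b (br c d e) =
      br (br a b c) d e + br c (br a b d) e + br c d (br a b e)
}.

Record is_comm_assoc_algebra mul : Prop := {
  caa_bilinear : bilinear_map mul;
  caa_comm : commutative mul;
  caa_assoc : associative mul
}.

Record is_Nambu_Poisson mul br : Prop := {
  np_comm_assoc : is_comm_assoc_algebra mul;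
  np_3Lie : is_3Lie br;
  np_leibniz : forall a b c d,
    br a b (mul c d) = mul (br a b c) d + mul c (br a b d)
}.

Section Representation.
Variable V : lmodType k.

(* A linear map A -> End(V) is represented by its curried form A -> V -> V:
   linearity of each [mu a] (that is, [mu a] in End(V)) together with linearity
   of [mu] amounts to [bilinear_map mu].  Likewise, a bilinear map
   A x A -> End(V) is a [trilinear_map].                                     *)
Implicit Types (mu : A -> V -> V) (rho : A -> A -> V -> V).

Record is_NP_representation mul br mu rho : Prop := {
  npr_mu_linear : bilinear_map mu;
  npr_rho_bilinear : trilinear_map rho;
  npr_rho_skew : skew_in_first_two rho;
  npr_mu_mul : forall a b, mu (mul a b) =1 mu a \o mu b;
  npr_rho_comm : forall a b c d,
    (rho a b \o rho c d) \- (rho c d \o rho a b)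
      =1 rho (br a b c) d \+ rho c (br a b d);
  npr_rho_br : forall a b c d,
    rho (br a b c) d
      =1 (rho a b \o rho c d) \+ (rho b c \o rho a d) \+ (rho c a \o rho b d);
  npr_mu_br : forall a b c,
    mu (br a b c) =1 (rho a b \o mu c) \- (mu c \o rho a b);
  npr_rho_mul : forall a b c,
    rho a (mul b c) =1 (mu b \o rho a c) \+ (mu c \o rho a b)
}.

Implicit Types (phi : A -> A -> V) (psi : A -> A -> A -> V).

Record is_Harrison_2cocycle mul mu phi : Prop := {
  harrison_bilinear : bilinear_map phi;
  harrison_sym : forall a b, phi a b = phi b a;
  harrison_cocycle : forall a b c,
    mu a (phi b c) - phi (mul a b) c + phi a (mul b c) - mu c (phi a b) = 0
}.

Record is_3Lie_2cocycle br rho psi : Prop := {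
  lie3c_trilinear : trilinear_map psi;
  lie3c_skew : skew_symmetric3 psi;
  lie3c_cocycle : forall a b c d e,
    psi a b (br c d e) + rho a b (psi c d e) =
      psi (br a b c) d e + psi c (br a b d) e + psi c d (br a b e)
      + rho d e (psi a b c) + rho e c (psi a b d) + rho c d (psi a b e)
}.

Record is_NP_2cocycle mul br mu rho phi psi : Prop := {
  npc_harrison : is_Harrison_2cocycle mul mu phi;
  npc_3Lie : is_3Lie_2cocycle br rho psi;
  npc_compat : forall a b c d,
    psi a b (mul c d) + rho a b (phi c d) =
      phi c (br a b d) + mu c (psi a b d)
      + phi (br a b c) d + mu d (psi a b c)
}.

End Representation.
End NambuPoisson.

Section NSNambuPoisson.
Variables (k : fieldType) (A : lmodType k).
Implicit Types (dia ast : A -> A -> A) (br dbr : A -> A -> A -> A).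

Definition sub_mul dia ast (a b : A) : A := dia a b + dia b a + ast a b.

Definition sub_br br dbr (a b c : A) : A :=
  br a b c + br b c a + br c a b + dbr a b c.

Record is_NS_commutative dia ast : Prop := {
  nsc_dia_bilinear : bilinear_map dia;
  nsc_ast_bilinear : bilinear_map ast;
  nsc_ast_comm : commutative ast;
  nsc_dia_dia : forall a b c,
    dia a (dia b c) = dia (sub_mul dia ast a b) c;
  nsc_dia_ast : forall a b c,
    dia a (ast b c) + ast a (sub_mul dia ast b c) =
      dia b (ast a c) + ast b (sub_mul dia ast a c)
}.

Record is_NS_3Lie br dbr : Prop := {
  nsl_br_trilinear : trilinear_map br;
  nsl_dbr_trilinear : trilinear_map dbr;
  nsl_br_skew : skew_in_first_two br;
  nsl_dbr_skew : skew_symmetric3 dbr;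
  nsl_br_br : forall a b c d e,
    br a b (br c d e) =
      br (sub_br br dbr a b c) d e + br c (sub_br br dbr a b d) e
      + br c d (br a b e);
  nsl_sub_br : forall a b c d e,
    br (sub_br br dbr a b c) d e =
      br a b (br c d e) + br b c (br a d e) + br c a (br b d e);
  nsl_dbr : forall a b c d e,
    dbr a b (sub_br br dbr c d e) + br a b (dbr c d e) =
      dbr (sub_br br dbr a b c) d e + dbr c (sub_br br dbr a b d) e
      + dbr c d (sub_br br dbr a b e)
      + br d e (dbr a b c) + br e c (dbr a b d) + br c d (dbr a b e)
}.

Record is_NS_Nambu_Poisson dia ast br dbr : Prop := {
  nsnp_commutative : is_NS_commutative dia ast;
  nsnp_3Lie : is_NS_3Lie br dbr;
  nsnp_sub_dia : forall a b c d,
    dia (sub_br br dbr a b c) d = br a b (dia c d) - dia c (br a b d);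
  nsnp_br_sub : forall a b c d,
    br (sub_mul dia ast a b) c d = dia a (br b c d) + dia b (br a c d);
  nsnp_mixed : forall a b c d,
    dbr a b (sub_mul dia ast c d) + br a b (ast c d) =
      ast c (sub_br br dbr a b d) + dia c (dbr a b d)
      + ast (sub_br br dbr a b c) d + dia d (dbr a b c)
}.

Definition mu_of dia : A -> A -> A := fun a b => dia a b.
Definition rho_of br : A -> A -> A -> A := fun a b c => br a b c.
Definition phi_of ast : A -> A -> A := fun a b => ast a b.
Definition psi_of dbr : A -> A -> A -> A := fun a b c => dbr a b c.

End NSNambuPoisson.

(* Main.v *)
(** Each axiom of the representation and of the 2-cocycle is an axiom of the
    NS-Nambu-Poisson algebra, up to commutativity or skew-symmetry.  The
    fundamental and Leibniz identities of the subadjacent algebra are obtained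
    by summing those axioms over the components of its operations; only
    rearrangements of sums remain. *)
Require Import Defs.
From mathcomp Require Import all_boot all_algebra.
Import GRing.Theory.
Local Open Scope ring_scope.

(* [ring] does not apply to modules.  The first summand on the left is moved to
   the front on the right and cancelled, repeatedly.  The summands must be
   pairwise distinct, otherwise the rewriting with [addrCA] may loop. *)
Ltac cancel_sums :=
  rewrite -?addrA;
  repeat match goal with
  | |- ?x = ?x => reflexivity
  | |- ?x + _ = _ =>
      do ?rewrite [in RHS](addrC _ x); do ?rewrite [in RHS](addrCA _ x);
      rewrite -?addrA; congr (x + _)
  end.

(** An axiom [x = y] added crosswise to the goal: what remains, [y + u = x + v], should hold by
    reordering alone, with no subtraction. *)
Lemma addr_transfer {V : zmodType} {x y u v : V} :
  x = y -> y + u = x + v -> u = v.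
Proof. by move=> ->; apply: addrI. Qed.

Section Multilinearity.
Context {k : fieldType} {A : lmodType k}.
Implicit Types (dia ast : A -> A -> A) (br dbr : A -> A -> A -> A).

Lemma linear_add {V W : lmodType k} {f g : V -> W} :
  linear f -> linear g -> linear (fun x => f x + g x).
Proof. by move=> fL gL c x y; rewrite fL gL scalerDr addrACA. Qed.

Lemma linear_additive {V W : lmodType k} {f : V -> W} :
  linear f -> {morph f : x y / x + y}.
Proof. by move=> fL x y; have := fL 1 x y; rewrite !scale1r. Qed.

Lemma linear_opp {V W : lmodType k} {f : V -> W} :
  linear f -> {morph f : x / - x}.
Proof.
move=> fL x; apply: (addIr (f x)); rewrite -(linear_additive fL) !addNr.
by apply: (addIr (f 0)); rewrite -(linear_additive fL) !add0r.
Qed.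

Lemma sub_mul_bilinear {dia ast} :
  bilinear_map dia -> bilinear_map ast -> bilinear_map (sub_mul dia ast).
Proof.
by move=> [dl dr] [al ar]; split=> x; do ?[apply: linear_add];
  do ?[exact: dl | exact: dr | exact: al | exact: ar].
Qed.

Lemma sub_br_trilinear {br dbr} :
  trilinear_map br -> trilinear_map dbr -> trilinear_map (sub_br br dbr).
Proof.
by move=> [b1 b2 b3] [d1 d2 d3]; split=> x y; do ?[apply: linear_add];
  do ?[exact: b1 | exact: b2 | exact: b3 | exact: d1 | exact: d2 | exact: d3].
Qed.

Lemma sub_mulC {dia ast} : commutative ast -> commutative (sub_mul dia ast).
Proof. by move=> aC a b; rewrite /sub_mul (aC b) (addrC (dia b a)). Qed.

Lemma sub_br_skew {br dbr} : skew_in_first_two br -> skew_symmetric3 dbr ->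
  skew_symmetric3 (sub_br br dbr).
Proof.
move=> bS dS a b c; have [d1 d2 d3] := dS a b c.
(* Signs are absorbed into swapped arguments, [- br a b c] becoming [br b a c], so that both sides
   list the same summands. *)
rewrite /sub_br d1 d2 d3 !opprD -!bS; split; by cancel_sums.
Qed.

End Multilinearity.

Section Subadjacent.
Context {k : fieldType} {A : lmodType k}.
Variables (dia ast : A -> A -> A) (br dbr : A -> A -> A -> A).

Local Notation mul := (sub_mul dia ast).
Local Notation sbr := (sub_br br dbr).

Let mE a b : mul a b = dia a b + dia b a + ast a b.
Proof. by []. Qed.

Let sE a b c : sbr a b c = br a b c + br b c a + br c a b + dbr a b c.
Proof. by []. Qed.

Lemma sub_mul_comm_assoc_algebra :
  is_NS_commutative dia ast -> is_comm_assoc_algebra mul.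
Proof.
case=> dL aL aC dd da; have mC := sub_mulC (dia := dia) aC.
split=> //; first exact: sub_mul_bilinear.
have dD a : {morph dia a : x y / x + y} by apply: linear_additive; case: dL.
(* The operators [dia a] commute because [mul] does; this matches all terms built from [dia]
   alone. *)
have diaCA a b c : dia a (dia b c) = dia b (dia a c) by rewrite !dd (mC a).
have dia_mul a b c :
    dia a (mul b c) = dia a (dia b c) + dia a (dia c b) + dia a (ast b c).
  by rewrite mE !dD.
move=> a b c.
rewrite (mE a (mul b c)) (mE (mul a b) c) -!dd !dia_mul (aC _ c) (aC (mul a b)).
rewrite (diaCA a c b) (diaCA b c a).
(* The terms containing [ast] form one instance of the compatibility axiom. *)
move: (da a c b); rewrite (aC c b) (mC c b) => /addr_transfer; apply.
by cancel_sums.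
Qed.

Lemma sub_br_3Lie : is_NS_3Lie br dbr -> is_3Lie sbr.
Proof.
case=> bL dL bS dS bb sb dbrE; split.
- exact: sub_br_trilinear.
- exact: sub_br_skew.
have [_ _ brL] := bL.
have bD a b := linear_additive (brL a b).
have br_sbr a b c d e : br a b (sbr c d e) =
    br a b (br c d e) + br a b (br d e c) + br a b (br e c d)
    + br a b (dbr c d e) by rewrite sE !bD.
have br_sbr_mid x c d e y : br x (sbr c d e) y =
    br c d (br x e y) + br d e (br x c y) + br e c (br x d y).
  rewrite bS sb !opprD (bS x e) (bS x c) (bS x d).
  by rewrite !(linear_opp (brL _ _)) !opprK.
move=> a b c d e.
rewrite (sE a b (sbr c d e)) (sE (sbr a b c) d e) (sE c (sbr a b d) e).
(* On the right, [sbr] in the first two slots of [br] stays folded: [bb], applied to the three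
   rotations of [c d e], produces exactly these terms. *)
rewrite (sE c d (sbr a b e)) !br_sbr (br_sbr_mid b) (sb c d e a b).
rewrite (bb a b c d e) (bb a b d e c) (bb a b e c d).
apply: (addr_transfer (dbrE a b c d e)).
by cancel_sums.
Qed.

Lemma NS_representation : is_NS_Nambu_Poisson dia ast br dbr ->
  is_NP_representation mul sbr (mu_of dia) (rho_of br).
Proof.
case=> [[dL _ _ dd _] [bL _ bS _ bb sb _] sd bm _].
split=> // [a b c | a b c d e | a b c d].
- by rewrite /= /mu_of dd.
- by rewrite /= /rho_of bb addrK.
(* The axiom has the product in the first slot; the signs of swapping there and back cancel. *)
- rewrite /= /rho_of /mu_of bS bm opprD (bS a) (bS a).
  by rewrite !(linear_opp (dL.2 _)) !opprK.
Qed.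

Lemma sub_Nambu_Poisson :
  is_NS_Nambu_Poisson dia ast br dbr -> is_Nambu_Poisson mul sbr.
Proof.
move=> hA.
have br_mul_mid a b c d : br a (mul b c) d = dia b (br a c d) + dia c (br a b d).
  exact: npr_rho_mul (NS_representation hA) a b c d.
case: hA => cA lA sd bm mx; split.
- exact: sub_mul_comm_assoc_algebra.
- exact: sub_br_3Lie.
case: cA => [[_ dL] _ _ _ _]; case: lA => [[_ _ bL] _ _ _ _ _ _].
have dD a := linear_additive (dL a); have bD a b := linear_additive (bL a b).
have br_dia a b c d : br a b (dia c d) = dia (sbr a b c) d + dia c (br a b d).
  by rewrite sd subrK.
have br_mul a b c d : br a b (mul c d) =
    br a b (dia c d) + br a b (dia d c) + br a b (ast c d) by rewrite !bD.
have dia_sbr x a b c : dia x (sbr a b c) =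
    dia x (br a b c) + dia x (br b c a) + dia x (br c a b) + dia x (dbr a b c).
  by rewrite !dD.
move=> a b c d; rewrite (sE a b (mul c d)) br_mul !br_dia br_mul_mid bm.
rewrite (mE (sbr a b c) d) (mE c (sbr a b d)) !dia_sbr.
(* The mixed axiom accounts for all terms in [ast] and [dbr]; the others already agree. *)
apply: (addr_transfer (mx a b c d)).
by cancel_sums.
Qed.

Lemma NS_2cocycle : is_NS_Nambu_Poisson dia ast br dbr ->
  is_NP_2cocycle mul sbr (mu_of dia) (rho_of br) (phi_of ast) (psi_of dbr).
Proof.
case=> [[_ aL aC _ da] [_ dL _ dS _ _ dbrE] _ _ mx].
split=> //; split=> // a b c.
have mC := sub_mulC (dia := dia) aC.
(* Up to commutativity, the Harrison identity is [da] at [a], [c], [b]. *)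
rewrite /mu_of /phi_of (addrAC (dia a _)) (aC b c) (mC b c) da.
by rewrite (aC (mul a b)) addrK subrr.
Qed.

End Subadjacent.

Theorem theorem4p7 (k : fieldType) (char_k0 : [pchar k] =i pred0)
    (A : lmodType k) (dia ast : A -> A -> A) (br dbr : A -> A -> A -> A)
    (hA : is_NS_Nambu_Poisson dia ast br dbr) :
  is_Nambu_Poisson (sub_mul dia ast) (sub_br br dbr) /\
  (is_NP_representation (sub_mul dia ast) (sub_br br dbr)
     (mu_of dia) (rho_of br) /\
   is_NP_2cocycle (sub_mul dia ast) (sub_br br dbr)
     (mu_of dia) (rho_of br) (phi_of ast) (psi_of dbr)).
Proof.
split; first exact: sub_Nambu_Poisson.
by split; [exact: NS_representation | exact: NS_2cocycle].
Qed.
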